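(* Let $G$ be an acyclic digraph with source $s$ and target $t$, with $m$ arcs. Then matrices $Q_1,\dots,Q_k$ spanning the set of linearizable matrices for the quadratic shortest path problem on $G$ can be computed in polynomial time (in the size of $G$).
   Context: $G=(V,A)$ has $n$ topologically sorted vertices $v_1=s,\dots,v_n=t$ ($(v_i,v_j)\in A$ implies $i<j$), and every vertex lies on at least one $s$-$t$ path. A cost matrix is a real symmetric $m\times m$ matrix $Q=(q_{e,f})_{e,f\in A}$ (the interaction cost of distinct arcs $e,f$ is $2q_{e,f}$) with zero diagonal. Let $\mathcal{P}\subseteq\{0,1\}^A$ be the set of characteristic vectors of $s$-$t$ paths. A cost matrix $Q$ is linearizable if there is $c\in\mathbb{R}^m$ with $x^{\mathrm T}Qx=c^{\mathrm T}x$ for all $x\in\mathcal{P}$. Matrices $Q_1,\dots,Q_k$ span the set of linearizable matrices if a cost matrix $Q$ is linearizable if and only if $Q=\sum_{i=1}^k\alpha_iQ_i$ for some $\alpha\in\mathbb{R}^k$. *)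

(* Defs.v *)
From HB Require Import structures.
From mathcomp Require Import all_boot all_order all_algebra.
From mathcomp Require Import reals.

Set Implicit Arguments.
Unset Strict Implicit.
Unset Printing Implicit Defensive.

Import Order.TTheory GRing.Theory Num.Theory.

(** * Polynomial time

    The machine is the random access machine of Aho, Hopcroft and Ullman (read-only
    input tape, write-only output tape, indirect addressing, memory initially zero)
    under the logarithmic cost criterion, which is polynomially equivalent to
    multitape Turing machines.  It is programmed by structured while-programs
    instead of jumps, works on natural numbers, and has no division. *)

Inductive expr : Type :=
| Const of nat
| Deref of expr
| Add of expr & expr
| Sub of expr & expr
| Mul of expr & expr.

Inductive cmd : Type :=
| Skip
| Store of expr & expr
| Read of expr
| Write of expr
| Seq of cmd & cmd
| If of expr & cmd & cmd
| While of expr & cmd.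

Record state : Type := State {
  mem : nat -> nat;
  inp : seq nat;
  out : seq nat
}.

(** Bit length, with [bitlen 0 = 1]. *)
Definition bitlen (n : nat) : nat := (trunc_log 2 n).+1.

Fixpoint eval (M : nat -> nat) (e : expr) : nat :=
  match e with
  | Const k => k
  | Deref a => M (eval M a)
  | Add a b => eval M a + eval M b
  | Sub a b => eval M a - eval M b
  | Mul a b => eval M a * eval M b
  end.

Fixpoint cost (M : nat -> nat) (e : expr) : nat :=
  match e with
  | Const k => bitlen k
  | Deref a => cost M a + bitlen (eval M a) + bitlen (M (eval M a))
  | Add a b | Sub a b | Mul a b =>
      cost M a + cost M b + bitlen (eval M a) + bitlen (eval M b)
  end.

Definition upd (M : nat -> nat) (a v : nat) : nat -> nat :=
  fun x => if x == a then v else M x.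

(** [exec c st t st']: started in [st], [c] halts in [st'] after time [t].
    Reading past the end of the input has no rule: the machine is stuck. *)
Inductive exec : cmd -> state -> nat -> state -> Prop :=
| exec_skip st : exec Skip st 1 st
| exec_store a e M i o :
    exec (Store a e) (State M i o)
      (cost M a + cost M e + bitlen (eval M a) + bitlen (eval M e))
      (State (upd M (eval M a) (eval M e)) i o)
| exec_read a M v i o :
    exec (Read a) (State M (v :: i) o)
      (cost M a + bitlen (eval M a) + bitlen v)
      (State (upd M (eval M a) v) i o)
| exec_write e M i o :
    exec (Write e) (State M i o)
      (cost M e + bitlen (eval M e))
      (State M i (rcons o (eval M e)))
| exec_seq c1 c2 st1 st2 st3 t1 t2 :
    exec c1 st1 t1 st2 -> exec c2 st2 t2 st3 ->
    exec (Seq c1 c2) st1 (t1 + t2) st3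
| exec_if e c1 c2 st st' t :
    exec (if eval (mem st) e != 0 then c1 else c2) st t st' ->
    exec (If e c1 c2) st (cost (mem st) e + t) st'
| exec_while_stop e c st :
    eval (mem st) e = 0 ->
    exec (While e c) st (cost (mem st) e) st
| exec_while_step e c st1 st2 st3 t1 t2 :
    eval (mem st1) e != 0 ->
    exec c st1 t1 st2 -> exec (While e c) st2 t2 st3 ->
    exec (While e c) st1 (cost (mem st1) e + t1 + t2) st3.

Definition computes_in (c : cmd) (x y : seq nat) (t : nat) : Prop :=
  exists st, exec c (State (fun _ => 0) x [::]) t st /\ out st = y.

(** One program that, on every instance [i], outputs the encoding of some solution
    of [i], in time polynomial in [size_in i]. *)
Definition poly_time_computable (I : Type) (O : I -> Type)
    (size_in : I -> nat) (enc_in : I -> seq nat)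
    (enc_out : forall i, O i -> seq nat)
    (is_solution : forall i, O i -> Prop) : Prop :=
  exists (c : cmd) (a d : nat), forall i : I, exists (o : O i) (t : nat),
    [/\ is_solution i o,
        computes_in c (enc_in i) (enc_out i o) t &
        t <= a * size_in i ^ d + a].

(** * Digraphs and their source-target paths *)

Definition adj (n m : nat) (arc : m.-tuple ('I_n * 'I_n)) : rel 'I_n :=
  fun u v => (u, v) \in arc.

(** A path is given by its vertices following the source. *)
Definition is_st_path (n m : nat) (arc : m.-tuple ('I_n.+1 * 'I_n.+1))
    (p : seq 'I_n.+1) : bool :=
  path (adj arc) ord0 p && (last ord0 p == ord_max).

(** Vertices are numbered in topological order, the first one being the source and
    the last one the target; arcs are numbered in the order of the tuple. *)
Record st_dag : Type := StDag {
  top : nat;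
  narcs : nat;
  arc : narcs.-tuple ('I_top.+1 * 'I_top.+1);
  arc_uniq : uniq arc;
  arc_sorted : forall e : 'I_narcs, (tnth arc e).1 < (tnth arc e).2;
  on_st_path : forall v : 'I_top.+1,
    exists p, is_st_path arc p /\ v \in ord0 :: p
}.

Definition dag_size (G : st_dag) : nat := (top G).+1 + narcs G.

Definition enc_dag (G : st_dag) : seq nat :=
  [:: (top G).+1, narcs G &
    flatten [seq [:: val a.1; val a.2] | a <- arc G]].

Local Open Scope ring_scope.

(** [zip (ord0 :: p) p] lists the arcs of the path. *)
Definition char_vec (R : realType) (G : st_dag) (p : seq 'I_(top G).+1) :
    'cV[R]_(narcs G) :=
  \col_e (tnth (arc G) e \in zip (ord0 :: p) p)%:R.

(** * Linearizable cost matrices *)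

Definition cost_matrix (R : realType) (m : nat) (Q : 'M[R]_m) : Prop :=
  Q^T = Q /\ forall e, Q e e = 0.

Definition linearizable (R : realType) (G : st_dag) (Q : 'M[R]_(narcs G)) : Prop :=
  exists c : 'cV[R]_(narcs G), forall p, is_st_path (arc G) p ->
    let x := char_vec R p in x^T *m Q *m x = c^T *m x.

Definition spans_linearizable (R : realType) (G : st_dag)
    (Qs : seq 'M[R]_(narcs G)) : Prop :=
  forall Q : 'M[R]_(narcs G), cost_matrix Q ->
    (linearizable Q <->
     exists alpha : 'I_(size Qs) -> R, Q = \sum_i alpha i *: Qs`_i).

(** * Output: lists of rational matrices *)

Definition enc_rat (q : rat) : seq nat :=
  [:: (q < 0)%R : nat; absz (numq q); absz (denq q)].

Definition enc_mx (m : nat) (Q : 'M[rat]_m) : seq nat :=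
  flatten [seq enc_rat (Q e f) | e <- enum 'I_m, f <- enum 'I_m].

Definition enc_mxs (m : nat) (Qs : seq 'M[rat]_m) : seq nat :=
  size Qs :: flatten [seq enc_mx Q | Q <- Qs].

(* Main.v *)
(** Every quadratic form that is linear on s-t paths is a combination of two
    families of forms with coefficients in {-1, 0, 1}: the incidence row of a vertex
    v times x_f (flow conservation at v), and x_e x_f - K x_f x_e, where K = 1 if
    some path contains both of e <> f, and K = 0 otherwise.

    Fix a path In(v) from s to v and a path Out(v) from v to t for every v.  If
    e = (a,b) precedes f = (c,d) on some path, evaluating a linearizable Q on the four
    paths that run through e or replace In(a) e by In(b), and through f or replace
    f Out(d) by Out(c), gives

      (In(a) + e - In(b))^T Q (f + Out(d) - Out(c)) = 0.

    This writes q_{e,f} as a difference at the ends of f of a potential depending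
    on e, plus a difference at the ends of e of a potential depending on f; these are
    the coefficients of the flow conservation forms.  No linear system has to be
    solved, and computing the spanning matrices reduces to reachability. *)

From mathcomp Require Import all_boot all_order all_algebra.
From mathcomp Require Import reals.
From mathcomp Require Import zify ring lra.
Require Import Defs.

Set Implicit Arguments.
Unset Strict Implicit.
Unset Printing Implicit Defensive.

Lemma bitlen_leS n : bitlen n <= n.+1.
Proof.
rewrite /bitlen ltnS; case: n => [|n]; first by rewrite trunc_log0.
by apply: leq_trans (ltnW (ltn_expl _ (isT : 1 < 2))) _; rewrite trunc_logP.
Qed.

(** * Bounding the running time *)

Definition poly_bounded (f : nat -> nat) : Prop :=
  exists a d, forall N, f N <= a * N ^ d + a.

Lemma poly_bounded_const k : poly_bounded (fun=> k).
Proof. by exists k, 0 => N; rewrite leq_addl. Qed.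

Lemma poly_bounded_id : poly_bounded id.
Proof. by exists 1, 1 => N; rewrite mul1n expn1 leq_addr. Qed.

(** The summand 1 covers [N = 0] with [d = 0], where [0 ^ 0 = 1] may exceed [0 ^ d']. *)
Lemma leq_expDl N d d' : N ^ d <= N ^ (d + d') + 1.
Proof.
case: N => [|N]; first by case: d => [|d]; [rewrite leq_addl | rewrite exp0n].
by apply: leq_trans (leq_addr _ _); rewrite leq_pexp2l ?leq_addr.
Qed.

Lemma poly_bounded_add f g :
  poly_bounded f -> poly_bounded g -> poly_bounded (fun N => f N + g N).
Proof.
move=> [a [d fP]] [b [d' gP]]; exists (2 * (a + b)), (d + d') => N.
have := fP N; have := gP N; have := leq_expDl N d d'.
have := leq_expDl N d' d; rewrite [d' + d]addnC.
move: (N ^ _) (N ^ _) (N ^ _) => x y z; nia.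
Qed.

Lemma poly_bounded_mul f g :
  poly_bounded f -> poly_bounded g -> poly_bounded (fun N => f N * g N).
Proof.
move=> [a [d fP]] [b [d' gP]]; exists (4 * (a * b)), (d + d') => N.
apply: leq_trans (leq_mul (fP N) (gP N)) _.
have := leq_expDl N d d'; have := leq_expDl N d' d.
rewrite [d' + d]addnC expnD; move: (N ^ _) (N ^ _) => x y h1 h2.
have -> : (a * x + a) * (b * y + b) = (a * b) * (x * y + x + y + 1) by nia.
have -> : 4 * (a * b) * (x * y) + 4 * (a * b) = (a * b) * (4 * (x * y) + 4) by nia.
by rewrite leq_mul2l; apply/orP; right; lia.
Qed.

(** A dereference yields a stored value, at most [B]; truncated subtraction never exceeds its first
    argument. *)
Fixpoint eval_bound (e : expr) (B : nat) : nat :=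
  match e with
  | Const k => k
  | Deref _ => B
  | Add a b => eval_bound a B + eval_bound b B
  | Sub a b => eval_bound a B
  | Mul a b => eval_bound a B * eval_bound b B
  end.

Fixpoint cost_bound (e : expr) (B : nat) : nat :=
  match e with
  | Const k => k.+1
  | Deref a => cost_bound a B + (eval_bound a B).+1 + B.+1
  | Add a b | Sub a b | Mul a b =>
      cost_bound a B + cost_bound b B + (eval_bound a B).+1 + (eval_bound b B).+1
  end.

(** Bounds the running time only if memory values stay below [B] and every loop makes
    at most [B] iterations. *)
Fixpoint time_bound (c : cmd) (B : nat) : nat :=
  match c with
  | Skip => 1
  | Store a e => cost_bound a B + cost_bound e B
                 + (eval_bound a B).+1 + (eval_bound e B).+1
  | Read a => cost_bound a B + (eval_bound a B).+1 + B.+1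
  | Write e => cost_bound e B + (eval_bound e B).+1
  | Seq c1 c2 => time_bound c1 B + time_bound c2 B
  | If e c1 c2 => cost_bound e B + (time_bound c1 B + time_bound c2 B)
  | While e c => B.+1 * (cost_bound e B + time_bound c B)
  end.

Lemma poly_bounded_succ f : poly_bounded f -> poly_bounded (fun N => (f N).+1).
Proof.
move=> fP; have [a [d H]] := poly_bounded_add fP (poly_bounded_const 1).
by exists a, d => N; rewrite -addn1.
Qed.

Create HintDb pb.
Hint Resolve poly_bounded_const poly_bounded_id poly_bounded_add
  poly_bounded_mul poly_bounded_succ : pb.

Lemma poly_bounded_eval e : poly_bounded (eval_bound e).
Proof. by elim: e => /=; auto with pb. Qed.
Hint Resolve poly_bounded_eval : pb.

Lemma poly_bounded_cost e : poly_bounded (cost_bound e).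
Proof. by elim: e => /= *; auto 9 with pb. Qed.
Hint Resolve poly_bounded_cost : pb.

Lemma poly_bounded_time c : poly_bounded (time_bound c).
Proof. by elim: c => /= *; auto 9 with pb. Qed.

(** * Hoare triples for total correctness within a time bound *)

Definition mem_le (B : nat) (M : nat -> nat) : Prop := forall x, M x <= B.

Lemma eval_le B M e : mem_le B M -> eval M e <= eval_bound e B.
Proof.
move=> MB; elim: e => //= a IHa b IHb; [exact: leq_add| |exact: leq_mul].
exact: leq_trans (leq_subr _ _) IHa.
Qed.

Lemma cost_le B M e : mem_le B M -> cost M e <= cost_bound e B.
Proof.
move=> MB.
have bl f : bitlen (eval M f) <= (eval_bound f B).+1.
  by apply: leq_trans (bitlen_leS _) _; rewrite ltnS eval_le.
elim: e => //= [k|a IHa|a IHa b IHb|a IHa b IHb|a IHa b IHb];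
  rewrite ?bitlen_leS ?leq_add //.
by apply: leq_trans (bitlen_leS _) _; rewrite ltnS.
Qed.

Lemma bitlen_eval_le B M e :
  mem_le B M -> bitlen (eval M e) <= (eval_bound e B).+1.
Proof. by move=> MB; apply: leq_trans (bitlen_leS _) _; rewrite ltnS eval_le. Qed.

Lemma mem_le_upd B M a v : mem_le B M -> v <= B -> mem_le B (upd M a v).
Proof. by move=> MB vB x; rewrite /upd; case: eqP. Qed.

(** A single [B] caps the memory values and the loop counts, so the running time is bounded from the
    text of the command and [B] alone. *)
Definition triple (B : nat) (P : state -> Prop) (c : cmd) (Q : state -> Prop) :=
  forall st, mem_le B (mem st) -> P st ->
  exists t st', [/\ exec c st t st', t <= time_bound c B, mem_le B (mem st') & Q st'].

Section Rules.

Variable B : nat.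
Implicit Types (P Q I : state -> Prop) (c : cmd).

Lemma triple_conseq P P' Q Q' c :
  (forall st, P st -> P' st) -> (forall st, Q' st -> Q st) ->
  triple B P' c Q' -> triple B P c Q.
Proof.
move=> PP' QQ' H st MB /PP' /(H st MB) [t [st' [? ? ? /QQ' ?]]].
by exists t, st'.
Qed.

Lemma triple_skip P : triple B P Skip P.
Proof. by move=> st MB Pst; exists 1, st; split => //; apply: exec_skip. Qed.

Lemma triple_store P a e :
  (forall st, P st -> eval (mem st) e <= B) ->
  triple B P (Store a e) (fun st => exists2 M,
    P (State M (inp st) (out st)) & mem st = upd M (eval M a) (eval M e)).
Proof.
move=> eB [M i o] MB PM; eexists; eexists; split; first exact: exec_store.
- by rewrite /= !leq_add ?cost_le ?bitlen_eval_le.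
- by apply: mem_le_upd => //; apply: eB PM.
- by exists M.
Qed.

Lemma triple_read P Q a :
  (forall M i o, P (State M i o) -> exists v i', [/\ i = v :: i', v <= B &
     Q (State (upd M (eval M a) v) i' o)]) ->
  triple B P (Read a) Q.
Proof.
move=> H [M i o] MB /H [v [i' [-> vB QM]]].
eexists; eexists; split; [exact: exec_read| |exact: mem_le_upd|exact: QM].
rewrite /= !leq_add ?cost_le ?bitlen_eval_le //.
by apply: leq_trans (bitlen_leS _) _.
Qed.

Lemma triple_write P Q e :
  (forall M i o, P (State M i o) -> Q (State M i (rcons o (eval M e)))) ->
  triple B P (Write e) Q.
Proof.
move=> H [M i o] MB /H QM.
eexists; eexists; split; [exact: exec_write| |by []|exact: QM].
by rewrite /= !leq_add ?cost_le ?bitlen_eval_le.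
Qed.

Lemma triple_seq P Q S c1 c2 :
  triple B P c1 S -> triple B S c2 Q -> triple B P (Seq c1 c2) Q.
Proof.
move=> H1 H2 st MB /(H1 st MB)[t1 [st1 [e1 l1 MB1 /(H2 st1 MB1)]]].
move=> [t2 [st2 [e2 l2 MB2 Q2]]]; exists (t1 + t2), st2; split => //=.
  exact: exec_seq e1 e2.
exact: leq_add.
Qed.

Lemma triple_if P Q e c1 c2 :
  triple B (fun st => P st /\ eval (mem st) e != 0) c1 Q ->
  triple B (fun st => P st /\ eval (mem st) e = 0) c2 Q ->
  triple B P (If e c1 c2) Q.
Proof.
move=> H1 H2 st MB Pst; have [e0|e0] := eqVneq (eval (mem st) e) 0.
  have [t [st' [x l MB' Q']]] := H2 st MB (conj Pst e0).
  exists (cost (mem st) e + t), st'; split => //=.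
    by apply: exec_if; rewrite e0.
  by rewrite leq_add ?cost_le // (leq_trans l) ?leq_addl.
have [t [st' [x l MB' Q']]] := H1 st MB (conj Pst e0).
exists (cost (mem st) e + t), st'; split => //=.
  by apply: exec_if; rewrite e0.
by rewrite leq_add ?cost_le // (leq_trans l) ?leq_addr.
Qed.

Definition var (x : nat) : expr := Deref (Const x).

Definition For (x y : nat) (c : cmd) : cmd :=
  Seq (Store (Const x) (Const 0))
      (While (Sub (var y) (var x))
             (Seq c (Store (Const x) (Add (var x) (Const 1))))).

(** The invariant tolerates any change of the counter, whose value is tracked separately and must
    survive the body. The induction is on the number [j] of remaining iterations; the last test of
    the guard is charged as one more pass. *)
Lemma triple_for (I : nat -> state -> Prop) x y k c :
  k <= B ->
  (forall i st, I i st -> mem st y = k) ->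
  (forall i M inp o v, I i (State M inp o) -> I i (State (upd M x v) inp o)) ->
  (forall i, i < k -> triple B (fun st => I i st /\ mem st x = i) c
                               (fun st => I i.+1 st /\ mem st x = i)) ->
  triple B (I 0) (For x y c) (I k).
Proof.
move=> kB Iy Ix Ic; apply: (@triple_seq _ _ (fun st => I 0 st /\ mem st x = 0)).
  apply: triple_conseq (@triple_store (I 0) _ _ _) => //.
  move=> [M i o] /= [M' I0 ->]; split; first exact: Ix.
  by rewrite /upd eqxx.
set e := Sub _ _; set c' := Seq _ _.
have body i : i < k -> triple B (fun st => I i st /\ mem st x = i) c'
    (fun st => I i.+1 st /\ mem st x = i.+1).
  move=> ik; apply: triple_seq (Ic i ik) _.
  apply: triple_conseq (@triple_store (fun st => I i.+1 st /\ mem st x = i) _ _ _).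
  - by [].
  - move=> [M j o] /= [M' [I' Mi] ->]; split; first exact: Ix.
    by rewrite /upd eqxx /= Mi addn1.
  - by move=> st [_ /= ->]; lia.
suff loop j i st : i + j = k -> mem_le B (mem st) -> I i st -> mem st x = i ->
    exists t st', [/\ exec (While e c') st t st',
      t <= j.+1 * (cost_bound e B + time_bound c' B), mem_le B (mem st') & I k st'].
  move=> st MB [I0 x0]; have [t [st' [H1 H2 H3 H4]]] := loop k 0 st erefl MB I0 x0.
  exists t, st'; split => //; apply: leq_trans H2 _ => /=.
  by rewrite leq_mul2r ltnS kB orbT.
elim: j i st => [|j IH] i st ijk MB Ii xi.
  move: ijk; rewrite addn0 => ik; subst i.
  exists (cost (mem st) e), st; split => //; last by rewrite -ik.
    apply: exec_while_stop; rewrite /= (Iy _ _ Ii); lia.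
  by rewrite mul1n (leq_trans (cost_le _ MB)) ?leq_addr.
have ik : i < k by lia.
have [t1 [st1 [e1 l1 MB1 [I1 x1]]]] := body i ik st MB (conj Ii xi).
have [|t2 [st2 [e2 l2 MB2 I2]]] := IH i.+1 st1 _ MB1 I1 x1; first by lia.
exists (cost (mem st) e + t1 + t2), st2; split => //.
  apply: exec_while_step e1 e2; rewrite /= (Iy _ _ Ii) xi; lia.
by rewrite mulSn; apply: leq_add => //; apply: leq_add => //; apply: cost_le.
Qed.

(** As [P] must hold again at the end, it may mention the counters of the loops that
    enclose [c], but not those of the loops in [c]. *)
Definition prints (P : (nat -> nat) -> Prop) (c : cmd) (s : seq nat) : Prop :=
  forall o, triple B (fun st => P (mem st) /\ out st = o) c
                     (fun st => P (mem st) /\ out st = o ++ s).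

Lemma prints_write (P : (nat -> nat) -> Prop) e v :
  (forall M, P M -> eval M e = v) -> prints P (Write e) [:: v].
Proof.
by move=> H o; apply: triple_write => M i o' /= [PM ->]; rewrite (H M PM) -cats1.
Qed.

Lemma prints_seq (P : (nat -> nat) -> Prop) c1 c2 s1 s2 :
  prints P c1 s1 -> prints P c2 s2 -> prints P (Seq c1 c2) (s1 ++ s2).
Proof. by move=> H1 H2 o; apply: triple_seq (H1 o) _; rewrite catA. Qed.

Lemma prints_for (P : (nat -> nat) -> Prop) x y k c s :
  k <= B -> (forall M, P M -> M y = k) ->
  (forall M v, P M -> P (upd M x v)) ->
  (forall i, i < k -> prints (fun M => P M /\ M x = i) c (s i)) ->
  prints P (For x y c) (flatten [seq s i | i <- iota 0 k]).
Proof.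
move=> kB Py Px H o.
pose I i st := P (mem st) /\ out st = o ++ flatten [seq s i | i <- iota 0 i].
apply: triple_conseq (@triple_for I x y k c kB _ _ _) => //.
- by move=> st [? ?]; split; rewrite ?cats0.
- by move=> i st [/Py].
- by move=> i M j o' v [/= ? ?]; split=> //=; apply: Px.
- move=> i ik; apply: triple_conseq (H i ik _).
    by move=> st [[PM oE] xi]; split => //; exact: oE.
  move=> st /= [[PM xi] oE]; do 2?split => //.
  by rewrite oE -[i.+1]addn1 iotaD map_cat flatten_cat /= cats0 catA.
Qed.

End Rules.

(** * The program *)

(** Cells 0 and 1 hold the numbers of vertices and arcs and cells 2 to 5 are loop
    counters; the three tables are interleaved modulo 3, so that they are disjoint
    whatever their sizes. *)
Definition tail_addr (e : expr) : expr := Add (Const 6) (Mul (Const 3) e).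
Definition head_addr (e : expr) : expr := Add (Const 7) (Mul (Const 3) e).
Definition reach_addr (u v : expr) : expr :=
  Add (Const 8) (Mul (Const 3) (Add (Mul u (var 0)) v)).
Definition tailX e := Deref (tail_addr e).
Definition headX e := Deref (head_addr e).
Definition reachX u v := Deref (reach_addr u v).

(** At most one of the two truncated differences is nonzero, so their sum is the distance between
    the values. *)
Definition eqX (a b : expr) : expr := Sub (Const 1) (Add (Sub a b) (Sub b a)).
Definition orX (a b : expr) : expr := Sub (Const 1) (Sub (Const 1) (Add a b)).

Lemma evalD M a b : eval M (Add a b) = eval M a + eval M b. Proof. by []. Qed.

Lemma evalM M a b : eval M (Mul a b) = eval M a * eval M b. Proof. by []. Qed.

Lemma eval_eqX M a b : eval M (eqX a b) = (eval M a == eval M b).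
Proof. by rewrite /=; case: eqP => /= ?; lia. Qed.

Lemma eval_orX M a b (p q : bool) :
  eval M a = p -> eval M b = q -> eval M (orX a b) = p || q.
Proof. by move=> /= -> ->; case: p; case: q. Qed.

Definition read_prog : cmd :=
  Seq (Read (Const 0)) (Seq (Read (Const 1))
    (For 2 1 (Seq (Read (tail_addr (var 2))) (Read (head_addr (var 2)))))).

Definition reach_prog : cmd :=
  For 2 0 (Seq (Store (reach_addr (var 2) (var 2)) (Const 1))
    (For 3 0 (For 4 1
      (If (reachX (var 2) (tailX (var 4)))
          (Store (reach_addr (var 2) (headX (var 4))) (Const 1))
          Skip)))).

(** Cells 2 and 3 index the matrix within its family, cells 4 and 5 are row and column. All entries
    are integers, so the denominator printed is 1. *)
Definition quad_prog (y : nat) (s a : expr) : cmd :=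
  For 2 y (For 3 1 (For 4 1 (For 5 1
    (Seq (Write s) (Seq (Write a) (Write (Const 1))))))).

Definition quad_out (k m : nat) (s a : nat -> nat -> nat -> nat -> nat) : seq nat :=
  flatten [seq flatten [seq flatten [seq flatten [seq
    [:: s v f g h; a v f g h; 1]
    | h <- iota 0 m] | g <- iota 0 m] | f <- iota 0 m] | v <- iota 0 k].

(** The entry is -1 exactly when the row arc leaves the vertex. Adding the two end tests gives the
    absolute value because no arc has equal ends. *)
Definition flow_sign := Mul (eqX (var 5) (var 3)) (eqX (tailX (var 4)) (var 2)).
Definition flow_abs :=
  Mul (eqX (var 5) (var 3)) (Add (eqX (headX (var 4)) (var 2)) (eqX (tailX (var 4)) (var 2))).

Definition compatX :=
  orX (reachX (headX (var 2)) (tailX (var 3))) (reachX (headX (var 3)) (tailX (var 2))).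
Definition swap_sign :=
  Mul compatX (Mul (eqX (var 4) (var 3)) (eqX (var 5) (var 2))).
Definition swap_abs :=
  Add (Mul (eqX (var 4) (var 2)) (eqX (var 5) (var 3))) swap_sign.

Definition spanning_prog : cmd :=
  Seq read_prog (Seq reach_prog
    (Seq (Write (Mul (Add (var 0) (var 1)) (var 1)))
      (Seq (quad_prog 0 flow_sign flow_abs) (quad_prog 1 swap_sign swap_abs)))).

(** * Correctness of the program for abstract arc tables *)

Section Correctness.

Variables (B n m : nat) (ta he : nat -> nat) (r : nat -> nat -> bool).
Hypotheses (nB : n <= B) (mB : m <= B) (B_gt0 : 0 < B).
Hypothesis taP : forall j, j < m -> ta j < he j.
Hypothesis heP : forall j, j < m -> he j < n.
(** Reachability enters through three closure properties: the first two make every mark sound, and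
    [r_inv] makes the marks complete. *)
Hypothesis r_refl : forall u, u < n -> r u u.
Hypothesis r_step : forall u j, u < n -> j < m -> r u (ta j) -> r u (he j).
Hypothesis r_inv : forall u b, u < n -> b < n -> r u b ->
  b = u \/ exists j, [/\ j < m, he j = b & r u (ta j)].

Lemma ta_ltn j : j < m -> ta j < n.
Proof. by move=> jm; apply: ltn_trans (taP jm) (heP jm). Qed.

Definition tail_cell j := 6 + 3 * j.
Definition head_cell j := 7 + 3 * j.
Definition reach_cell u v := 8 + 3 * (u * n + v).

Lemma reach_cell_inj a b u v : b < n -> v < n ->
  reach_cell a b = reach_cell u v -> a = u /\ b = v.
Proof.
move=> bn vn /eqP; rewrite eqn_add2l eqn_mul2l /= => /eqP H.
have n0 : 0 < n by lia.
have := congr1 (divn^~ n) H; have := congr1 (modn^~ n) H.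
by rewrite !modnMDl !modn_small // !divnMDl // !divn_small // !addn0.
Qed.

Definition arcs_upto k (M : nat -> nat) : Prop :=
  [/\ M 0 = n, M 1 = m &
      forall j, j < k -> M (tail_cell j) = ta j /\ M (head_cell j) = he j].

Lemma arcs_upto_upd k M x v :
  1 < x -> x < 6 \/ (exists a, x = 8 + 3 * a) -> arcs_upto k M -> arcs_upto k (upd M x v).
Proof.
move=> x1 xP [M0 M1 MA]; rewrite /upd; split.
- by case: eqP => // ?; lia.
- by case: eqP => // ?; lia.
move=> j jk; have [<- <-] := MA j jk; rewrite /tail_cell /head_cell.
by split; case: eqP => // ?; case: xP => [|[a]]; lia.
Qed.

Definition arcs_input k := flatten [seq [:: ta j; he j] | j <- iota k (m - k)].

Lemma arcs_inputS k : k < m -> arcs_input k = [:: ta k, he k & arcs_input k.+1].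
Proof. by rewrite /arcs_input => km; rewrite (_ : m - k = (m - k.+1).+1) //; lia. Qed.

Definition reach_zero (M : nat -> nat) := forall a, M (8 + 3 * a) = 0.

Lemma triple_read_prog :
  triple B (fun st => [/\ mem st = (fun=> 0), inp st = [:: n, m & arcs_input 0]
                        & out st = [::]])
    read_prog
    (fun st => [/\ arcs_upto m (mem st), reach_zero (mem st) & out st = [::]]).
Proof.
pose I k st := [/\ arcs_upto k (mem st), reach_zero (mem st),
                   inp st = arcs_input k & out st = [::]].
pose P1 st := [/\ mem st 0 = n, reach_zero (mem st),
  inp st = m :: arcs_input 0 & out st = [::]].
apply: (@triple_seq _ _ _ P1).
  apply: triple_read => M i o /= [-> -> ->]; exists n, (m :: arcs_input 0).
  by split => //; split.
apply: (@triple_seq _ _ _ (I 0)).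
  apply: triple_read => M i o [/= M0 MR -> ->]; exists m, (arcs_input 0).
  by split => //; split.
apply: triple_conseq (@triple_for _ I 2 1 m _ mB _ _ _).
- by [].
- by move=> st [? ? _ ?].
- by move=> i st [[]].
- by [].
move=> k km.
pose J st := [/\ arcs_upto k (mem st), reach_zero (mem st), mem st 2 = k,
  mem st (tail_cell k) = ta k /\ inp st = he k :: arcs_input k.+1 & out st = [::]].
have taB : ta k <= B by have := ta_ltn km; lia.
have heB : he k <= B by have := heP km; lia.
apply: (@triple_seq _ _ _ J); apply: triple_read => M i o /=.
  move=> [[/= [M0 M1 MA] MR -> ->] M2]; rewrite arcs_inputS // M2.
  exists (ta k), (he k :: arcs_input k.+1); split => //.
  split => //=; rewrite /upd //.
  - split => // j jk; have [<- <-] := MA j jk; rewrite /tail_cell /head_cell.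
    by split; case: eqP => // ?; lia.
  - by move=> a; rewrite MR; case: eqP => // ?; lia.
  - by rewrite eqxx.
move=> [/= [M0 M1 MA] MR M2 [Mt ->] ->]; rewrite M2.
exists (he k), (arcs_input k.+1); split => //; split => //; split => //=.
- split => // j; rewrite ltnS leq_eqVlt => /predU1P[->|jk].
    by split; rewrite /upd ?eqxx // -Mt /tail_cell; case: eqP => // ?; lia.
  have [<- <-] := MA j jk; rewrite /upd /tail_cell /head_cell.
  by split; case: eqP => // ?; lia.
- by move=> a; rewrite /upd MR; case: eqP => // ?; lia.
Qed.

Definition sound M := forall a b, a < n -> b < n -> M (reach_cell a b) <= r a b.
Definition marked (M : nat -> nat) a b := 0 < M (reach_cell a b).

Lemma marked_upd M a b x : marked M a b -> marked (upd M x 1) a b.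
Proof. by rewrite /marked /upd; case: eqP. Qed.

Lemma upd_lt6 M x v z : x < 6 -> 5 < z -> upd M x v z = M z.
Proof. by rewrite /upd; case: eqP => // ?; lia. Qed.

Definition rows_done u M := forall a b, a < u -> b < n -> r a b -> marked M a b.
Definition row_upto u k M := forall b, b < k -> b < n -> r u b -> marked M u b.

Definition graph_mem M :=
  arcs_upto m M /\ forall u v, u < n -> v < n -> M (reach_cell u v) = r u v.

(** After [k] rounds from [u] the marks are complete on the vertices below [k], because
    the last arc of a path to vertex [k] leaves a smaller vertex. *)
Lemma triple_reach_prog o :
  triple B (fun st => [/\ arcs_upto m (mem st), reach_zero (mem st) & out st = o])
    reach_prog (fun st => graph_mem (mem st) /\ out st = o).
Proof.
(* Soundness holds for all rows, completeness for the finished ones; at [u = n] the two together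
   give [graph_mem]. *)
pose inv u M := [/\ arcs_upto m M, sound M & rows_done u M].
have inv_cnt u M x v : 1 < x < 6 -> inv u M -> inv u (upd M x v).
  move=> /andP[x1 x6] [Ma Ms Mr]; split; first by apply: arcs_upto_upd => //; left.
    by move=> a b an bn; rewrite upd_lt6 //; apply: Ms.
  by move=> a b au bn ab; rewrite /marked upd_lt6 //; apply: Mr.
have inv_mark u M a b : a < n -> b < n -> r a b -> inv u M -> inv u (upd M (reach_cell a b) 1).
  move=> an bn ab [Ma Ms Mr]; split.
  - by apply: arcs_upto_upd => //; right; eexists.
  - move=> a' b' an' bn'; rewrite /upd; case: eqP => [|_]; last exact: Ms.
    by case/reach_cell_inj => // -> ->; rewrite ab.
  - by move=> a' b' au bn' rab; apply: marked_upd; apply: Mr.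
pose I1 u st := inv u (mem st) /\ out st = o.
apply: triple_conseq (@triple_for _ I1 2 0 n _ nB _ _ _).
- move=> st [Ma M0 oE]; split => //; split => // a b an bn.
  by rewrite /reach_cell M0.
- move=> st [[Ma Ms Mr] oE]; split => //; split => // u v un vn.
  have := Ms u v un vn; have := Mr u v un vn; rewrite /marked.
  by case: (r u v) => [/(_ isT)|_]; lia.
- by move=> i st [[[]]].
- by move=> i M j o' v [? ?]; split => //; apply: inv_cnt.
move=> u un.
pose I2 k st := [/\ inv u (mem st), mem st 2 = u, marked (mem st) u u,
                    row_upto u k (mem st) & out st = o].
apply: (@triple_seq _ _ _ (I2 0)).
  pose P st := I1 u st /\ mem st 2 = u.
  apply: triple_conseq (@triple_store _ P _ _ _) => // st.
  move=> [M [[Hi /= oE] /= M2]]; have [[/= M0 _ _] _ _] := Hi; rewrite M0 M2 => memE.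
  rewrite /I2 memE; split => //.
  - by apply: inv_mark => //; apply: r_refl.
  - by rewrite /marked /upd eqxx.
apply: triple_conseq (@triple_for _ I2 3 0 n _ nB _ _ _).
- by [].
- move=> st [[Ma Ms Mr] M2 _ Mu oE]; split => //; split => //; split => // a b.
  rewrite ltnS leq_eqVlt => /predU1P[->|au]; last exact: Mr.
  by move=> bn; apply: Mu.
- by move=> i st [[[]]].
- by move=> k M j o' v [/= Hi M2 Mu Mr oE]; split => //=.
move=> k kn.
(* Arcs with tail below [k] suffice: every arc into vertex [k] is among them, and their reachable
   tails are marked before the round starts. *)
pose I3 j st := [/\ I2 k st, mem st 3 = k & forall i, i < j -> i < m -> ta i < k ->
  r u (ta i) -> marked (mem st) u (he i)].
apply: triple_conseq (@triple_for _ I3 4 1 m _ mB _ _ _).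
- by move=> st [? ?]; split.
- move=> st [[Hi M2 Mu Mr oE] M3 H]; split => //; split => // b.
  rewrite ltnS leq_eqVlt => /predU1P[->|bk]; last exact: Mr.
  move=> _ uk; have [->//|[j [jm heE rt]]] := r_inv un kn uk.
  by rewrite -heE; apply: H => //; rewrite -heE; apply: taP.
- by move=> i st [[[[]]]].
- by move=> j M i o' v [/= [/= Hi M2 Mu Mr oE] M3 H]; split => //=; split.
move=> j jm; apply: triple_if.
  pose P st := [/\ I3 j st, mem st 4 = j & 0 < mem st (reach_cell u (ta j))].
  apply: triple_conseq (@triple_store _ P _ _ _) => //.
  - move=> st [[H M4] /=]; have [[[[M0 M1 MA] _ _] M2 _ _ _] _ _] := H.
    have [mt _] := MA j jm; rewrite M0 M2 M4 -/(tail_cell j) mt -lt0n => nz.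
    by split.
  - move=> st [M [[/= [/= Hi M2 Mu Mr oE] M3 H] /= M4 Mt]].
    have [[/= M0 _ MA] Ms _] := Hi; have [_ mh] := MA j jm.
    rewrite M0 M2 M4 -/(head_cell j) mh => memE.
    have rt : r u (ta j) by have := Ms u _ un (ta_ltn jm); case: (r u _) => //; lia.
    rewrite /I3 /I2 memE; do 3?split => //.
    + by apply: inv_mark => //; [apply: heP | apply: r_step].
    + exact: marked_upd.
    + by move=> b bk bn ub; apply: marked_upd; apply: Mr.
    move=> i; rewrite ltnS leq_eqVlt => /predU1P[->|ij].
      by rewrite /marked /upd eqxx.
    by move=> im tk ut; apply: marked_upd; apply: H.
(* An unmarked tail below [k] is unreachable by [row_upto], so skipping the arc loses nothing. *)
apply: triple_conseq (@triple_skip _ (fun st => [/\ I3 j st, mem st 4 = j &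
    mem st (reach_cell u (ta j)) = 0])) => //.
- move=> st [[H M4] /=]; have [[[[M0 M1 MA] _ _] M2 _ _ _] _ _] := H.
  have [mt _] := MA j jm; rewrite M0 M2 M4 -/(tail_cell j) mt => z.
  by split.
move=> st [[H2 M3 H] M4 Mt]; split => //; split => // i.
rewrite ltnS leq_eqVlt => /predU1P[->|ij]; last exact: H.
move=> _ tk ut; have [_ _ _ Mr _] := H2.
by have := Mr _ tk (ta_ltn jm) ut; rewrite /marked Mt.
Qed.

Lemma prints_quad y k s a S A : k <= B ->
  (forall M, graph_mem M -> M y = k) ->
  (forall M, graph_mem M -> M 2 < k -> M 3 < m -> M 4 < m -> M 5 < m ->
    eval M s = S (M 2) (M 3) (M 4) (M 5) /\ eval M a = A (M 2) (M 3) (M 4) (M 5)) ->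
  prints B graph_mem (quad_prog y s a) (quad_out k m S A).
Proof.
move=> kB yk H; have M1 M : graph_mem M -> M 1 = m by case=> [[]].
apply: prints_for => // v vk.
apply: prints_for => // [M [/M1]//|f fm].
apply: prints_for => // [M [[/M1]]//|g gm].
apply: prints_for => // [M [[[/M1]]]//|h hm].
have val M : (((graph_mem M /\ M 2 = v) /\ M 3 = f) /\ M 4 = g) /\ M 5 = h ->
    eval M s = S v f g h /\ eval M a = A v f g h.
  move=> [[[[gM E2] E3] E4] E5].
  by have := H M gM; rewrite E2 E3 E4 E5; apply.
rewrite -[[:: _; _; _]]/([:: _] ++ ([:: _] ++ [:: _])).
apply: prints_seq; first by apply: prints_write => M /val[].
by apply: prints_seq; apply: prints_write => // M /val[].
Qed.

Definition flow_sgn (v f g h : nat) : nat := (h == f) * (ta g == v).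
Definition flow_mag (v f g h : nat) : nat := (h == f) * ((he g == v) + (ta g == v)).
Definition swap_sgn (e f g h : nat) : nat :=
  (r (he e) (ta f) || r (he f) (ta e)) * ((g == f) * (h == e)).
Definition swap_mag (e f g h : nat) : nat := (g == e) * (h == f) + swap_sgn e f g h.

Lemma prints_flow :
  prints B graph_mem (quad_prog 0 flow_sign flow_abs) (quad_out n m flow_sgn flow_mag).
Proof.
apply: prints_quad => // [M [[]]//|M [[M0 M1 MA] _] _ _ g _].
have [mt mh] := MA _ g.
have Et : eval M (tailX (var 4)) = ta (M 4) by [].
have Eh : eval M (headX (var 4)) = he (M 4) by [].
by rewrite /flow_sign /flow_abs !evalM evalD !eval_eqX Et Eh.
Qed.

Lemma prints_swap :
  prints B graph_mem (quad_prog 1 swap_sign swap_abs) (quad_out m m swap_sgn swap_mag).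
Proof.
apply: prints_quad => // [M [[]]//|M [[M0 M1 MA] MR] e f _ _].
have [te hE] := MA _ e; have [tf hf] := MA _ f.
have Ec : eval M compatX = r (he (M 2)) (ta (M 3)) || r (he (M 3)) (ta (M 2)).
  apply: eval_orX; rewrite -MR ?heP ?ta_ltn // -?te -?tf -?hE -?hf;
    by rewrite /reach_cell -M0.
have Es : eval M swap_sign = swap_sgn (M 2) (M 3) (M 4) (M 5).
  by rewrite /swap_sign !evalM Ec !eval_eqX.
by rewrite /swap_abs evalD evalM Es !eval_eqX.
Qed.

Lemma spanning_prog_correct :
  exists2 t, computes_in spanning_prog [:: n, m & arcs_input 0]
    (n * m + m * m :: quad_out n m flow_sgn flow_mag ++ quad_out m m swap_sgn swap_mag) t
  & t <= time_bound spanning_prog B.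
Proof.
have W : prints B graph_mem (Write (Mul (Add (var 0) (var 1)) (var 1))) [:: n * m + m * m].
  by apply: prints_write => M [[M0 M1 _] _] /=; rewrite M0 M1 mulnDl.
have out := prints_seq W (prints_seq prints_flow prints_swap).
have := triple_seq triple_read_prog (triple_seq (triple_reach_prog (o := [::])) (out [::])).
case/(_ (State (fun=> 0) [:: n, m & arcs_input 0] [::])) => //.
move=> t [st [ex tB _ [_ oE]]]; exists t => //; exists st; split => //.
Qed.

End Correctness.

(** * Spanning the linearizable matrices *)

Section Walks.

Import GRing.Theory Num.Theory.
Local Open Scope ring_scope.

Variable G : st_dag.
Notation V := 'I_(top G).+1.
Notation E := 'I_(narcs G).
Notation tl e := (tnth (arc G) e).1.
Notation hd e := (tnth (arc G) e).2.
Notation reaches := (connect (adj (arc G))).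

(** * Precedence of arcs along paths *)

Definition compat (e f : E) : bool := reaches (hd e) (tl f) || reaches (hd f) (tl e).

Lemma adj_arc e : adj (arc G) (tl e) (hd e).
Proof. by rewrite /adj -surjective_pairing mem_tnth. Qed.

Lemma adj_ltn u v : adj (arc G) u v -> (u < v)%N.
Proof. by rewrite /adj => /tnthP[e E]; have := arc_sorted e; rewrite -E. Qed.

Lemma path_ltn (u : V) p : path (adj (arc G)) u p -> path ltn u (map val p).
Proof.
by elim: p u => //= v p IH u /andP[/adj_ltn -> /IH ->].
Qed.

Lemma path_uniq (u : V) p : path (adj (arc G)) u p -> uniq (u :: p).
Proof.
move=> /path_ltn H; rewrite -(map_inj_uniq val_inj).
exact: (@sorted_uniq _ ltn ltn_trans ltnn (val u :: map val p)).
Qed.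

Lemma reaches_leq u v : reaches u v -> (u <= v)%N.
Proof.
move=> /connectP[p /path_ltn /(order_path_min ltn_trans) /allP H ->].
case: (lastP p) H => //= q w; rewrite last_rcons map_rcons => H.
by apply/ltnW/H; rewrite mem_rcons mem_head.
Qed.

Lemma compat_irr e : compat e e = false.
Proof.
by apply/negP; rewrite /compat orbb => /reaches_leq; have := arc_sorted e; lia.
Qed.

Lemma compatC e f : compat e f = compat f e.
Proof. by rewrite /compat orbC. Qed.

Lemma reaches_zip (u : V) p a :
  path (adj (arc G)) u p -> a \in zip (u :: p) p -> reaches u a.1.
Proof.
elim: p u => //= v p IH u /andP[uv pp]; rewrite inE => /predU1P[-> //|].
by move=> /(IH _ pp); apply: connect_trans; apply: connect1.
Qed.

(** The head of whichever arc is met first reaches the tail of the other along the rest of the walk.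
    They cannot both be the first arc, since arcs are listed without repetition. *)
Lemma path_compat (u : V) p e f :
  path (adj (arc G)) u p -> tnth (arc G) e \in zip (u :: p) p ->
  tnth (arc G) f \in zip (u :: p) p -> e != f -> compat e f.
Proof.
elim: p u => //= v p IH u /andP[uv pp]; rewrite !inE.
move=> /predU1P[Ee|ein] /predU1P[Ef|fin]; last exact: IH pp ein fin.
- case/eqP; apply: (tuple_uniqP _ (arc_uniq G)); by rewrite Ee.
- by move=> _; rewrite /compat Ee (reaches_zip pp fin).
- by move=> _; rewrite /compat Ef (reaches_zip pp ein) orbT.
Qed.

Definition incid (F : fieldType) (v : V) (e : E) : F := (hd e == v)%:R - (tl e == v)%:R.

Definition flow_mx (F : fieldType) (v : V) (f : E) : 'M[F]_(narcs G) :=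
  \matrix_(g, h) ((h == f)%:R * incid F v g).

(** Not symmetric in general, which is harmless since spanning is only tested on
    cost matrices.  The case [e = f] yields the diagonal unit matrices. *)
Definition swap_mx (F : fieldType) (e f : E) : 'M[F]_(narcs G) :=
  delta_mx e f - (compat e f)%:R *: delta_mx f e.

(** * Arc-count vectors of walks and flow conservation *)

Variable R : realType.
Implicit Types (Q : 'M[R]_(narcs G)) (x y : 'cV[R]_(narcs G)).

(** Counting arcs instead of testing membership makes concatenation of paths additive. *)
Definition walk_vec (u : V) (p : seq V) : 'cV[R]_(narcs G) :=
  \col_e (count_mem (tnth (arc G) e) (zip (u :: p) p))%:R.

Lemma walk_vec_cat u p q :
  walk_vec u (p ++ q) = walk_vec u p + walk_vec (last u p) q.
Proof.
apply/colP=> e; rewrite !mxE -natrD; congr (_%:R).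
by elim: p u => //= v p IH u; rewrite IH addnA.
Qed.

Lemma walk_vec_arc e p :
  walk_vec (tl e) (hd e :: p) = delta_mx e 0 + walk_vec (hd e) p.
Proof.
apply/colP=> f; rewrite !mxE eqxx andbT -natrD /= -surjective_pairing.
by rewrite (inj_eq (tuple_uniqP _ (arc_uniq G))) eq_sym.
Qed.

(** The topological order prevents a path from repeating a vertex, so each count is 0 or 1. *)
Lemma char_vec_walk p : path (adj (arc G)) ord0 p -> char_vec R p = walk_vec ord0 p.
Proof.
move=> pp; apply/colP=> e; rewrite !mxE count_uniq_mem //.
by apply: zip_uniql; apply: path_uniq pp.
Qed.

(** Flow conservation: the contributions of inner vertices telescope. *)
Lemma walk_vec_incid v u p : path (adj (arc G)) u p ->
  \sum_e incid R v e * walk_vec u p e 0 = (last u p == v)%:R - (u == v)%:R.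
Proof.
elim: p u => [|w p IH] u /=; first by rewrite big1 ?subrr // => e _; rewrite mxE mulr0.
move=> /andP[/tnthP[e Ee] pp].
have [-> ->] : u = tl e /\ w = hd e by rewrite -Ee.
under eq_bigr do rewrite walk_vec_arc mxE mulrDr.
rewrite big_split /= (bigD1 e) //= big1 ?addr0 => [|f fe]; last first.
  by rewrite mxE (negbTE fe) mulr0.
have -> : hd e = w by rewrite -Ee.
by rewrite IH // mxE !eqxx mulr1 /incid -Ee /=; ring.
Qed.

(** * Quadratic forms, and linearizability of the two families *)

Definition qform Q x := (x^T *m Q *m x) 0 0.

Lemma qformE Q x : qform Q x = \sum_e \sum_f x e 0 * Q e f * x f 0.
Proof.
rewrite /qform mxE exchange_big; apply: eq_bigr => f _.
by rewrite mxE mulr_suml; apply: eq_bigr => e _; rewrite mxE.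
Qed.

Lemma linearizableE Q : linearizable Q <->
  exists c : E -> R, forall p, is_st_path (arc G) p ->
    qform Q (char_vec R p) = \sum_e c e * char_vec R p e 0.
Proof.
split=> [[c Hc]|[c Hc]].
  exists (fun e => c e 0) => p /Hc; rewrite /qform => ->.
  by rewrite mxE; apply: eq_bigr => e _; rewrite mxE.
exists (\col_e c e) => p /Hc H; apply/matrixP=> i j; rewrite !ord1 -/(qform _ _) H.
by rewrite mxE; apply: eq_bigr => e _; rewrite !mxE.
Qed.

Lemma linearizable_lin a Q Q' :
  linearizable Q -> linearizable Q' -> linearizable (a *: Q + Q').
Proof.
move=> [c Hc] [c' Hc']; exists (a *: c + c') => p pp x.
rewrite mulmxDr mulmxDl -scalemxAr -scalemxAl Hc // Hc' //.
by rewrite linearD linearZ /= mulmxDl -scalemxAl.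
Qed.

Lemma linearizable0 : linearizable (0 : 'M[R]_(narcs G)).
Proof. by exists 0 => p _ x; rewrite mulmx0 trmx0 !mul0mx. Qed.

Lemma linearizable_sum (I : finType) (a : I -> R) (F : I -> 'M[R]_(narcs G)) :
  (forall i, linearizable (F i)) -> linearizable (\sum_i a i *: F i).
Proof.
move=> H; elim/big_rec: _ => [|i Q _ HQ]; first exact: linearizable0.
exact: linearizable_lin.
Qed.

(** The incidence row of [v] has the same value on all source-target paths, so the form is a fixed
    multiple of [x_f] there. *)
Lemma linearizable_flow_mx v f : linearizable (flow_mx R v f).
Proof.
apply/linearizableE; exists (fun e => (e == f)%:R * ((ord_max == v)%:R - (ord0 == v)%:R)).
move=> p /andP[pp /eqP lp]; rewrite qformE char_vec_walk // exchange_big.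
apply: eq_bigr => h _; have := walk_vec_incid v pp; rewrite lp => <-.
rewrite -mulrA mulr_suml mulr_sumr; apply: eq_bigr => g _; rewrite [flow_mx R _ _ _ _]mxE; ring.
Qed.

(** For compatible arcs the two monomials cancel. Distinct incompatible arcs never share a path, so
    the product vanishes. For [e = f] the form is [x_e ^ 2 = x_e], the only case with a nonzero
    linear cost. *)
Lemma linearizable_swap_mx e f : linearizable (swap_mx R e f).
Proof.
have qd g h x : qform (delta_mx g h) x = x g 0 * x h 0.
  rewrite qformE (bigD1 g) //= (bigD1 h) //= !big1 ?addr0 => [|i ig|i].
  - by rewrite mxE !eqxx mulr1.
  - by rewrite big1 // => j _; rewrite mxE (negbTE ig) mulr0 mul0r.
  - by move=> /negbTE ih; rewrite mxE ih andbF mulr0 mul0r.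
apply/linearizableE; exists (fun g => ((e == f) && (g == e))%:R) => p /andP[pp _].
have -> x : qform (swap_mx R e f) x = (~~ compat e f)%:R * (x e 0 * x f 0).
  rewrite /qform mulmxBr mulmxBl -scalemxAr -scalemxAl.
  rewrite mxE [X in _ + X]mxE [X in _ - X]mxE -!/(qform _ _).
  by rewrite !qd; case: compat => /=; ring.
rewrite !mxE; have [<-|ef] /= := eqVneq e f.
  rewrite compat_irr mul1r (bigD1 e) //= big1 ?addr0 => [|g /negbTE->]; last by rewrite mul0r.
  by rewrite eqxx mul1r mxE; case: (_ \in _); rewrite ?mulr1 ?mulr0.
rewrite [RHS]big1 => [|g _]; last by rewrite mul0r.
case: (boolP (compat e f)); rewrite ?mul0r ?mul1r // => Nc.
case: (boolP (_ \in _)) => [ein|]; rewrite ?mul0r // mul1r.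
case: (boolP (_ \in _)) => [fin|] //.
by case/negP: Nc; apply: path_compat pp ein fin ef.
Qed.

(** * The exchange identity *)

Lemma stpath_through (v : V) : exists p q : seq V,
  [/\ path (adj (arc G)) ord0 p, last ord0 p = v,
      path (adj (arc G)) v q & last v q = ord_max].
Proof.
have [p [/andP[pp /eqP lp] vp]] := on_st_path v.
case/splitPl: vp pp lp => p1 p2 lp1; rewrite cat_path last_cat lp1 => /andP[? ?] ?.
by exists p1, p2.
Qed.

Definition bform Q x y : R := (x^T *m Q *m y) 0 0.

Lemma bformDl Q x x' y : bform Q (x + x') y = bform Q x y + bform Q x' y.
Proof. by rewrite /bform linearD /= !mulmxDl mxE. Qed.

Lemma bformDr Q x y y' : bform Q x (y + y') = bform Q x y + bform Q x y'.
Proof. by rewrite /bform mulmxDr mxE. Qed.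

Lemma bformC Q x y : Q^T = Q -> bform Q x y = bform Q y x.
Proof.
move=> QT; have -> : bform Q x y = (x^T *m Q *m y)^T 0 0 by rewrite [RHS]mxE.
by rewrite !trmx_mul trmxK QT mulmxA.
Qed.

Lemma bform_delta Q e f : bform Q (delta_mx e 0) (delta_mx f 0) = Q e f.
Proof. by rewrite /bform trmx_delta -rowE -colE !mxE. Qed.

(** A mixed second difference: terms involving [m], or only one of the two varying ends, cancel.
    Symmetry merges the two orders of each cross term into the factor 2. *)
Lemma bform_exchange Q a a' m b b' : Q^T = Q ->
  qform Q (a + (m + b)) - qform Q (a + (m + b'))
  - qform Q (a' + (m + b)) + qform Q (a' + (m + b'))
  = 2 * (bform Q a b - bform Q a b' - bform Q a' b + bform Q a' b').
Proof.
move=> QT; rewrite -![qform _ _]/(bform _ _ _) !bformDl !bformDr.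
rewrite (bformC b a) // (bformC b a') // (bformC b' a) // (bformC b' a') //.
ring.
Qed.

(** The four paths share a middle walk from [hd e] to [tl f]. Linear costs add over the three pieces
    and cancel in the alternating sum. The conclusion is the product of the two differences,
    expanded and grouped so as to match the potentials chosen later. *)
Lemma linearizable_exchange Q (pin pout : V -> seq V) :
  Q^T = Q -> linearizable Q ->
  (forall v, path (adj (arc G)) ord0 (pin v) /\ last ord0 (pin v) = v) ->
  (forall v, path (adj (arc G)) v (pout v) /\ last v (pout v) = ord_max) ->
  let I v := walk_vec ord0 (pin v) in
  let O v := walk_vec v (pout v) in
  forall e f, reaches (hd e) (tl f) ->
  bform Q (I (tl e)) (delta_mx f 0 + O (hd f)) - bform Q (I (tl e)) (O (tl f))
  + Q e f + bform Q (delta_mx e 0) (O (hd f)) - bform Q (delta_mx e 0) (O (tl f))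
  - bform Q (I (hd e)) (delta_mx f 0 + O (hd f)) + bform Q (I (hd e)) (O (tl f)) = 0.
Proof.
move=> QT /linearizableE[c Hc] Hin Hout I O e f /connectP[m pm lm].
pose J x : R := \sum_e c e * x e 0.
have JD x y : J (x + y) = J x + J y.
  by rewrite /J -big_split /=; apply: eq_bigr => i _; rewrite mxE mulrDr.
(* One evaluation for all four paths: [a] and [b] are the vectors of the prefix [p] and the suffix
   [q] around the middle walk [m]. *)
have H a b p q : path (adj (arc G)) ord0 p -> last ord0 p = hd e ->
    path (adj (arc G)) (tl f) q -> last (tl f) q = ord_max ->
    a = walk_vec ord0 p -> b = walk_vec (tl f) q ->
    qform Q (a + (walk_vec (hd e) m + b))
    = J a + (J (walk_vec (hd e) m) + J b).
  move=> pp lp pq lq -> ->; rewrite -!JD {1}lm.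
  have pth : path (adj (arc G)) ord0 (p ++ m ++ q).
    by rewrite !cat_path pp lp pm -lm pq.
  rewrite -lm -lp.
  have := Hc (p ++ m ++ q); rewrite /is_st_path pth !last_cat lp -lm lq eqxx.
  move=> /(_ isT); rewrite char_vec_walk // !walk_vec_cat lp -lm.
  exact.
have [[p1 l1] [p2 l2]] := (Hin (tl e), Hin (hd e)).
have [[p3 l3] [p4 l4]] := (Hout (hd f), Hout (tl f)).
have hp : path (adj (arc G)) ord0 (rcons (pin (tl e)) (hd e)).
  by rewrite rcons_path p1 l1 adj_arc.
have hq : path (adj (arc G)) (tl f) (hd f :: pout (hd f)).
  by rewrite /= adj_arc p3.
have wI : I (tl e) + delta_mx e 0 = walk_vec ord0 (rcons (pin (tl e)) (hd e)).
  rewrite -cats1 walk_vec_cat l1 walk_vec_arc; congr (_ + _).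
  rewrite -[LHS]addr0; congr (_ + _); apply/colP=> g; by rewrite !mxE.
have wO := esym (walk_vec_arc f (pout (hd f))).
have := bform_exchange (I (tl e) + delta_mx e 0) (I (hd e)) (walk_vec (hd e) m)
  (delta_mx f 0 + O (hd f)) (O (tl f)) QT.
rewrite (H _ _ _ _ hp (last_rcons _ _ _) hq l3 wI wO).
rewrite (H _ _ _ _ hp (last_rcons _ _ _) p4 l4 wI erefl).
rewrite (H _ _ _ _ p2 l2 hq l3 erefl wO) (H _ _ _ _ p2 l2 p4 l4 erefl erefl).
rewrite !(bformDl, bformDr) bform_delta => X.
lra.
Qed.

(** * Decomposition of a linearizable matrix *)

Definition spanning_sum (mu : V -> E -> R) (beta : E -> E -> R) :=
  \sum_v \sum_f mu v f *: flow_mx R v f + \sum_e \sum_f beta e f *: swap_mx R e f.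

Lemma flow_mx_sum (mu : V -> E -> R) g h :
  (\sum_v \sum_f mu v f *: flow_mx R v f) g h = mu (hd g) h - mu (tl g) h.
Proof.
rewrite summxE; under eq_bigr => v _.
  rewrite summxE (bigD1 h) //= big1 ?addr0 => [|f /negbTE fh]; last first.
    by rewrite !mxE eq_sym fh mul0r mulr0.
  rewrite !mxE eqxx mul1r /incid mulrBr; over.
rewrite sumrB; congr (_ - _).
  rewrite (bigD1 (hd g)) //= eqxx mulr1 big1 ?addr0 // => v /negbTE vg.
  by rewrite eq_sym vg mulr0.
rewrite (bigD1 (tl g)) //= eqxx mulr1 big1 ?addr0 // => v /negbTE vg.
by rewrite eq_sym vg mulr0.
Qed.

Lemma swap_mx_sum (beta : E -> E -> R) g h :
  (\sum_e \sum_f beta e f *: swap_mx R e f) g h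
  = beta g h - (compat g h)%:R * beta h g.
Proof.
have dsum (F : E -> E -> R) : \sum_e \sum_f F e f *: delta_mx e f = \matrix_(e, f) F e f.
  by rewrite [RHS]matrix_sum_delta; do 2!apply: eq_bigr => ? _; rewrite mxE.
rewrite summxE; under eq_bigr do rewrite summxE.
transitivity (\sum_e \sum_f ((beta e f *: delta_mx e f : 'M[R]_(narcs G)) g h
   - ((beta e f * (compat e f)%:R) *: delta_mx f e : 'M[R]_(narcs G)) g h)).
  do 2!apply: eq_bigr => ? _; rewrite !mxE; ring.
under eq_bigr do rewrite sumrB.
rewrite sumrB; congr (_ - _).
  under eq_bigr do rewrite -summxE.
  by rewrite -summxE dsum mxE.
rewrite exchange_big; under eq_bigr do rewrite -summxE.
rewrite -summxE (dsum (fun e f => beta f e * (compat f e)%:R)) mxE.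
by rewrite mulrC compatC.
Qed.

Lemma linearizable_in_span Q : Q^T = Q -> linearizable Q ->
  exists mu beta, Q = spanning_sum mu beta.
Proof.
move=> QT lQ.
have /fin_all_exists[pin Hin] (v : V) : exists p : seq V,
    path (adj (arc G)) ord0 p /\ last ord0 p = v.
  by have [p [q []]] := stpath_through v; exists p.
have /fin_all_exists[pout Hout] (v : V) : exists p : seq V,
    path (adj (arc G)) v p /\ last v p = ord_max.
  by have [p [q []]] := stpath_through v; exists q.
pose I v := walk_vec ord0 (pin v); pose O v := walk_vec v (pout v).
(* For fixed [f] this is a vertex potential: the first branch serves arcs before [f], the second
   arcs after [f], and 0 is for vertices unrelated to [f]. The factor 2 matches [Q e f + Q f e]. *)
pose mu v f := if reaches v (tl f)
  then 2 * (bform Q (I v) (delta_mx f 0 + O (hd f)) - bform Q (I v) (O (tl f)))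
  else if reaches (hd f) v then - 2 * bform Q (delta_mx f 0) (O v) else 0.
pose M := Q - \sum_v \sum_f mu v f *: flow_mx R v f.
have ME g h : M g h = Q g h - (mu (hd g) h - mu (tl g) h).
  by rewrite /M mxE [X in _ + X]mxE flow_mx_sum.
(* On compatible pairs [M] will be antisymmetric, so halves give [beta e f - beta f e = M e f].
   Elsewhere, diagonal included, [swap_mx] is a unit matrix and the entry is copied. *)
pose beta e f := if compat e f then M e f / 2 else M e f.
have M_anti e f : reaches (hd e) (tl f) -> M e f + M f e = 0.
  move=> ef; have Qfe : Q f e = Q e f by rewrite -[in LHS]QT mxE.
  rewrite !ME Qfe /mu.
  have le := arc_sorted e; have lf := arc_sorted f; have lef := reaches_leq ef.
  (* Both ends of [e] fall in the first branch for [f], both ends of [f] in the second branch for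
     [e]; the sum is then twice the exchange identity. *)
  have r1 : reaches (tl e) (tl f) := connect_trans (connect1 (adj_arc e)) ef.
  have r2 : reaches (hd e) (hd f) := connect_trans ef (connect1 (adj_arc f)).
  have n1 : reaches (hd f) (tl e) = false by apply/negP => /reaches_leq; lia.
  have n2 : reaches (tl f) (tl e) = false by apply/negP => /reaches_leq; lia.
  rewrite ef r1 r2 n1 n2.
  have := linearizable_exchange QT lQ Hin Hout ef; rewrite -/(I _) -/(O _) /=.
  rewrite -/(I _) -/(I _) -/(O _) -/(O _) => X; lra.
exists mu, beta; rewrite /spanning_sum -[LHS](subrKC (\sum_v \sum_f mu v f *: flow_mx R v f)).
congr (_ + _); rewrite -/M; apply/matrixP=> e f; rewrite swap_mx_sum /beta compatC.
case: (boolP (compat f e)) => [|_]; last by rewrite mul0r subr0.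
by case/orP=> /M_anti H; rewrite mul1r; lra.
Qed.

(** * The spanning list over the rationals and the reals *)

Definition spanning_mxs (F : fieldType) : seq 'M[F]_(narcs G) :=
  [seq flow_mx F v f | v <- enum 'I_(top G).+1, f <- enum 'I_(narcs G)] ++
  [seq swap_mx F e f | e <- enum 'I_(narcs G), f <- enum 'I_(narcs G)].

Lemma map_spanning_mxs : map (map_mx ratr) (spanning_mxs rat) = spanning_mxs R.
Proof.
rewrite /spanning_mxs map_cat !map_allpairs; congr (_ ++ _);
  apply: eq_allpairs => // v f; apply/matrixP=> g h; rewrite !mxE.
  by rewrite rmorphM rmorphB !rmorph_nat.
by rewrite rmorphB rmorphM !rmorph_nat.
Qed.

Lemma linearizable_spanning_mxs Q : Q \in spanning_mxs R -> linearizable Q.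
Proof.
rewrite mem_cat => /orP[] /allpairsP[[v f] [_ _ ->]].
  exact: linearizable_flow_mx.
exact: linearizable_swap_mx.
Qed.

Definition in_span (Qs : seq 'M[R]_(narcs G)) Q : Prop :=
  exists alpha : 'I_(size Qs) -> R, Q = \sum_i alpha i *: Qs`_i.

Lemma in_span_add Qs Q Q' : in_span Qs Q -> in_span Qs Q' -> in_span Qs (Q + Q').
Proof.
move=> [a ->] [b ->]; exists (fun i => a i + b i).
by rewrite -big_split; apply: eq_bigr => i _; rewrite scalerDl.
Qed.

Lemma in_span_sum Qs (I : finType) (a : I -> R) (F : I -> 'M[R]_(narcs G)) :
  (forall i, F i \in Qs) -> in_span Qs (\sum_i a i *: F i).
Proof.
move=> H; elim/big_rec: _ => [|i Q _].
  by exists (fun=> 0); rewrite big1 // => i; rewrite scale0r.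
apply: in_span_add; have lti : (index (F i) Qs < size Qs)%N by rewrite index_mem.
(* The whole coefficient goes to the first occurrence of [F i], as the list may contain
   repetitions. *)
exists (fun j => (j == Ordinal lti)%:R * a i).
rewrite (bigD1 (Ordinal lti)) //= eqxx mul1r nth_index // big1 ?addr0 // => j /negbTE ->.
by rewrite mul0r scale0r.
Qed.

Lemma spans_spanning_mxs : spans_linearizable (spanning_mxs R).
Proof.
move=> Q [QT _]; split=> [/(linearizable_in_span QT)[mu [beta ->]]|[alpha ->]].
  apply: in_span_add; rewrite pair_bigA; apply: in_span_sum => -[v f];
    rewrite mem_cat; apply/orP; [left|right];
    by apply/allpairsP; exists (v, f); rewrite !mem_enum.
by apply: linearizable_sum => i; apply: linearizable_spanning_mxs; apply: mem_nth.
Qed.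

End Walks.

(** * Encoding the output *)

Section Encoding.

Variable G : st_dag.
Let n := (top G).+1.
Let m := narcs G.

Definition tail_of (j : nat) : nat := (nth (ord0, ord0) (arc G) j).1.
Definition head_of (j : nat) : nat := (nth (ord0, ord0) (arc G) j).2.
(** Reachability on vertex numbers, as the program sees it; [inord] sends numbers beyond the last
    vertex to [ord0]. *)
Definition reaches (u v : nat) : bool := connect (adj (arc G)) (inord u) (inord v).

Lemma tail_ofE (e : 'I_m) : tail_of e = (tnth (arc G) e).1.
Proof. by rewrite (tnth_nth (ord0, ord0)). Qed.

Lemma head_ofE (e : 'I_m) : head_of e = (tnth (arc G) e).2.
Proof. by rewrite (tnth_nth (ord0, ord0)). Qed.

Lemma enc_dagE : enc_dag G = [:: n, m & arcs_input m tail_of head_of 0].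
Proof.
rewrite /enc_dag /arcs_input subn0; congr [:: _, _ & flatten _].
rewrite -[in LHS](mkseq_nth (ord0, ord0) (arc G)) size_tuple /mkseq -map_comp.
exact: eq_map.
Qed.

Lemma reaches_step u j : u < n -> j < m -> reaches u (tail_of j) -> reaches u (head_of j).
Proof.
move=> un jm; rewrite /reaches => /connect_trans; apply; apply: connect1.
rewrite -[j]/(val (Ordinal jm)) tail_ofE head_ofE !inord_val.
exact: adj_arc.
Qed.

Lemma reaches_inv u b : u < n -> b < n -> reaches u b ->
  b = u \/ exists j, [/\ j < m, head_of j = b & reaches u (tail_of j)].
Proof.
move=> un bn /connectP[p]; case/lastP: p => [|p v].
  by move=> _ /(congr1 val); rewrite /= !inordK //; left.
rewrite rcons_path last_rcons => /andP[pp /tnthP[e Ee]] Ev; right.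
exists e; rewrite head_ofE tail_ofE -Ee -Ev /= inordK //; split => //.
by rewrite /reaches inord_val; apply/connectP; exists p.
Qed.

Lemma flatten_map_allpairs (S T : Type) (W : Type) (F : W -> seq nat)
    (f : S -> T -> W) s t :
  flatten [seq F x | x <- [seq f a b | a <- s, b <- t]]
  = flatten [seq flatten [seq F (f a b) | b <- t] | a <- s].
Proof. by elim: s => //= a s IH; rewrite map_cat flatten_cat IH -map_comp. Qed.

Lemma map_iota_ord k (T : Type) (s : nat -> T) :
  [seq s i | i <- iota 0 k] = [seq s i | i : 'I_k <- enum 'I_k].
Proof. by rewrite -val_enum_ord -map_comp. Qed.

Lemma enc_quad k (F : 'I_k -> 'I_m -> 'M[rat]_m)
    (S A : nat -> nat -> nat -> nat -> nat) :
  (forall v f g h, enc_rat (F v f g h) = [:: S v f g h; A v f g h; 1]) ->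
  flatten [seq enc_mx Q | Q <- [seq F v f | v <- enum 'I_k, f <- enum 'I_m]]
  = quad_out k m S A.
Proof.
move=> H; rewrite flatten_map_allpairs /quad_out map_iota_ord.
congr flatten; apply: eq_map => v; rewrite map_iota_ord.
congr flatten; apply: eq_map => f; rewrite map_iota_ord /enc_mx.
rewrite -[X in flatten X = _]map_id flatten_map_allpairs.
congr flatten; apply: eq_map => g; rewrite map_iota_ord.
by congr flatten; apply: eq_map => h; rewrite H.
Qed.

Lemma enc_spanning_mxs : enc_mxs (spanning_mxs G rat) =
  n * m + m * m :: quad_out n m (flow_sgn tail_of) (flow_mag tail_of head_of)
    ++ quad_out m m (swap_sgn tail_of head_of reaches) (swap_mag tail_of head_of reaches).
Proof.
rewrite /enc_mxs /spanning_mxs size_cat !size_allpairs !size_enum_ord map_cat flatten_cat.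
congr (_ :: _ ++ _); apply: enc_quad; [move=> v f g h | move=> e f g h].
  rewrite !mxE /incid /flow_sgn /flow_mag tail_ofE head_ofE !val_eqE.
  (* Excludes the case where the end tests cancel in the entry but add up to 2 in the printed
     magnitude. *)
  have : ~~ (((tnth (arc G) g).2 == v) && ((tnth (arc G) g).1 == v)).
    by apply/negP => /andP[/eqP hE /eqP tE]; have := arc_sorted g; rewrite hE tE ltnn.
  by case: (h == f); case: (_ == v); case: (_ == v).
rewrite !mxE /swap_mag /swap_sgn !tail_ofE !head_ofE /reaches !inord_val !val_eqE.
rewrite -/(compat e f).
(* The entries 1 and -1 never overlap, since overlapping forces [e = f], and no arc is compatible
   with itself. *)
have : ~~ [&& compat e f, g == e, h == f, g == f & h == e].
  by apply/negP => /and5P[cef /eqP-> /eqP-> /eqP eE _]; rewrite eE compat_irr in cef.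
by case: compat; case: (g == e); case: (h == f); case: (g == f); case: (h == e).
Qed.

End Encoding.

Theorem proposition7p9 (R : realType) :
  poly_time_computable
    (I := st_dag) (O := fun G => seq 'M[rat]_(narcs G))
    dag_size enc_dag (fun G Qs => enc_mxs Qs)
    (fun G Qs => spans_linearizable (R := R) (map (map_mx ratr) Qs)).
Proof.
(* The constants depend on the program alone, hence are uniform in the graph. The bound [B] is then
   [dag_size G], which dominates vertex and arc numbers. *)
have [a [d bound]] := poly_bounded_time spanning_prog.
exists spanning_prog, a, d => G; exists (spanning_mxs G rat).
have [] := @spanning_prog_correct (dag_size G) (top G).+1 (narcs G)
  (tail_of G) (head_of G) (reaches G).
- exact: leq_addr.
- exact: leq_addl.
- by [].
- by move=> j jm; rewrite (tail_ofE (Ordinal jm)) (head_ofE (Ordinal jm)) arc_sorted.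
- by move=> j jm; rewrite (head_ofE (Ordinal jm)).
- by move=> u _; apply: connect0.
- exact: reaches_step.
- exact: reaches_inv.
move=> t run tB; exists t; split; last exact: leq_trans tB (bound _).
  by rewrite map_spanning_mxs; apply: spans_spanning_mxs.
by rewrite enc_dagE enc_spanning_mxs.
Qed.
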